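(* Let $0<\alpha<1$ be an irrational number. The sturmian subshift $(\Omega_\alpha,T)$ is linearly recurrent if and only if the coefficients (partial quotients) of the continued fraction of $\alpha$ are bounded.
   Context: Sturmian subshift: for irrational $0<\alpha<1$ let $R_\alpha:[0,1)\to[0,1)$, $R_\alpha(t)=t+\alpha \pmod 1$, and $I_\alpha:[0,1)\to\{0,1\}$ with $I_\alpha(t)=0$ if $t\in[0,1-\alpha)$ and $I_\alpha(t)=1$ otherwise. Then $\Omega_\alpha\subset\{0,1\}^{\mathbb Z}$ is the closure of $\{(I_\alpha(R_\alpha^n(t)))_{n\in\mathbb Z}: t\in[0,1)\}$, and $T$ is the shift; $(\Omega_\alpha,T)$ is the sturmian subshift generated by $\alpha$. Linearly recurrent: let $x\in A^{\mathbb Z}$ ($A$ finite) and let $L(x)$ be the set of finite words occurring in $x$. For a non-empty $u\in L(x)$, a return word to $u$ of $x$ is a word $w$ such that $wu\in L(x)$, $u$ is a prefix of $wu$, and $u$ has exactly two occurrences in $wu$. The sequence $x$ is uniformly recurrent if for each word of $L(x)$ the differences between successive occurrences in $x$ are bounded. $x$ is linearly recurrent (LR) with constant $K\in\mathbb N$ if it is uniformly recurrent and $|w|\le K|u|$ for every non-empty $u\in L(x)$ and every return word $w$ to $u$ of $x$. A subshift is linearly recurrent if it is minimal (no proper non-empty closed shift-invariant subset) and contains an LR sequence (with some constant $K$). *)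

(* Defs.v *)
From mathcomp Require Import all_boot all_order all_algebra.
From mathcomp Require Import all_classical all_reals all_analysis.
Set Implicit Arguments.
Unset Strict Implicit.
Unset Printing Implicit Defensive.
Import Order.TTheory GRing.Theory Num.Theory.
Local Open Scope classical_set_scope.
Local Open Scope ring_scope.

Section words.
Variable A : finType.
Implicit Types (x : int -> A) (u v w : seq A) (n m : int).

Definition occurs_at x u n : Prop := u = mkseq (fun i => x (n + i%:Z)) (size u).

Definition language x u : Prop := exists n, occurs_at x u n.

Definition nb_occurrences u v : nat :=
  count (fun i => prefix u (drop i v)) (iota 0 (size v - size u).+1%N).

Definition return_word x u w : Prop :=
  [/\ language x (w ++ u), prefix u (w ++ u) & nb_occurrences u (w ++ u) = 2%N].

(* Every occurrence of u has a next and a previous one, at distance at most B.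
   Mere boundedness of the gaps that happen to exist would accept sequences
   such as ...0001000..., in which the word 1 does not recur. *)
Definition uniformly_recurrent x : Prop :=
  forall u, language x u -> exists B : nat, forall n, occurs_at x u n ->
    (exists2 m : int, n < m <= n + B%:Z & occurs_at x u m) /\
    (exists2 m : int, n - B%:Z <= m < n & occurs_at x u m).

Definition linearly_recurrent_with (K : nat) x : Prop :=
  uniformly_recurrent x /\
  forall u w, u != [::] -> language x u -> return_word x u w ->
    (size w <= K * size u)%N.

Definition linearly_recurrent_seq x : Prop :=
  exists K : nat, linearly_recurrent_with K x.

End words.

(* {0,1}^Z, with 0 = false and 1 = true, under the product topology. *)
Definition biseq : topologicalType := {ptws int -> bool}.

Definition left_shift (x : biseq) : biseq := fun n : int => x (n + 1).

Record subshift := Subshift {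
  points : set biseq;
  subshift_closed : closed points;
  subshift_invariant : left_shift @` points = points }.

Definition minimal (X : subshift) : Prop :=
  forall Y : subshift,
    points Y `<=` points X -> points Y !=set0 -> points Y = points X.

Definition linearly_recurrent (X : subshift) : Prop :=
  minimal X /\ exists2 x : biseq, points X x & linearly_recurrent_seq x.

Lemma translation_continuous (a : int) :
  continuous ((fun x n => x (n + a)) : biseq -> biseq).
Proof.
move=> x; apply/cvg_sup => n; apply/cvg_image.
  by apply/seteqP; split=> // b _; exists (fun=> b).
move=> B nB; exists ((fun y : biseq => y n) @^-1` B); last first.
  by apply/seteqP; split=> [b [y By <-]//|b Bb]; exists (fun=> b).
exact: (@proj_continuous int (fun=> bool) (n + a) x B nB).
Qed.

Lemma closure_image_continuous (S T : topologicalType) (f : S -> T) (C : set S) :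
  continuous f -> f @` closure C `<=` closure (f @` C).
Proof.
move=> cf _ [x clx <-] B /cf /clx [y [Cy By]].
by exists (f y); split=> //; exists y.
Qed.

Lemma shift_closure (C : set biseq) :
  left_shift @` C = C -> left_shift @` closure C = closure C.
Proof.
move=> sC; pose unshift : biseq -> biseq := fun x n => x (n + -1).
have shiftK : cancel left_shift unshift.
  by move=> x; apply/funext => n; rewrite /unshift /left_shift addrNK.
have unshiftK : cancel unshift left_shift.
  by move=> x; apply/funext => n; rewrite /unshift /left_shift addrK.
have usC : unshift @` C = C.
  apply/seteqP; split=> [_ [x Cx <-]|x Cx].
    by move: Cx; rewrite -{1}sC => -[y Cy <-]; rewrite shiftK.
  by exists (left_shift x); rewrite ?shiftK// -sC; exists x.
apply/seteqP; split=> [|x clx].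
  have := @closure_image_continuous _ _ left_shift C (@translation_continuous 1).
  by rewrite sC; exact.
exists (unshift x) => //; rewrite -usC.
have := @closure_image_continuous _ _ unshift C (@translation_continuous (-1)).
by move=> /(_ (unshift x)); apply; exists x.
Qed.

Section sturmian.
Variable R : realType.
Implicit Types (alpha t : R) (n : int).

Definition rotation alpha t : R := t + alpha - (Num.floor (t + alpha))%:~R.

Lemma rotation_in alpha t : rotation alpha t \in `[0, 1[.
Proof.
rewrite in_itv /= /rotation subr_ge0 Num.Theory.floor_le /= ltrBlDl.
by have := floorD1_gt (t + alpha); rewrite intrD.
Qed.

Lemma rotationK alpha t :
  t \in `[0, 1[ -> rotation (- alpha) (rotation alpha t) = t.
Proof.
rewrite in_itv /= => /andP[t0 t1]; rewrite /rotation.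
set k := Num.floor (t + alpha).
have -> : t + alpha - k%:~R - alpha = t + (- k)%:~R.
  by rewrite mulrNz addrAC addrK.
rewrite floorDrz ?intr_int// intrKfloor.
by rewrite (@floor_def _ t 0) ?t0//= add0r addrK.
Qed.

(* The n-th iterate of R_alpha for n in Z; the inverse of R_alpha on [0,1[ is
   the rotation by - alpha (rotationK). *)
Definition rotation_iter alpha n t : R :=
  match n with
  | Posz k => iter k (rotation alpha) t
  | Negz k => iter k.+1 (rotation (- alpha)) t
  end.

Definition sturmian_letter alpha t : bool := t \notin `[0, 1 - alpha[.

Definition sturmian_coding alpha t : biseq :=
  fun n : int => sturmian_letter alpha (rotation_iter alpha n t).

Definition sturmian_set alpha : set biseq :=
  closure [set sturmian_coding alpha t | t in `[0, 1[].

Lemma rotation_iterS alpha n t : t \in `[0, 1[ ->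
  rotation_iter alpha (n + 1) t = rotation_iter alpha n (rotation alpha t).
Proof.
move=> t01; case: n => [k|[|k]].
- by rewrite -PoszD addn1 /= -iterSr.
- by rewrite /= rotationK.
- have -> : Negz k.+1 + 1 = Negz k by rewrite !NegzE -[in LHS]addn1 PoszD opprD addrNK.
  by rewrite /rotation_iter (iterSr k.+1) rotationK.
Qed.

Lemma shift_sturmian_coding alpha t : t \in `[0, 1[ ->
  left_shift (sturmian_coding alpha t) = sturmian_coding alpha (rotation alpha t).
Proof.
by move=> t01; apply/funext => n; rewrite /left_shift /sturmian_coding rotation_iterS.
Qed.

Lemma sturmian_set_invariant alpha :
  left_shift @` sturmian_set alpha = sturmian_set alpha.
Proof.
apply: shift_closure; apply/seteqP; split=> [_ [_ [t t01 <-] <-]|_ [t t01 <-]].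
  exists (rotation alpha t); first exact: rotation_in.
  by rewrite shift_sturmian_coding.
exists (sturmian_coding alpha (rotation (- alpha) t)).
  by exists (rotation (- alpha) t) => //; exact: rotation_in.
rewrite shift_sturmian_coding ?rotation_in//.
by have := rotationK (- alpha) t01; rewrite opprK => ->.
Qed.

Definition sturmian_subshift alpha : subshift :=
  Subshift (@closed_closure _ _) (sturmian_set_invariant alpha).

(* alpha = [a_0; a_1, a_2, ...], where a_n is the floor of the n-th complete
   quotient; a_0 = 0 if 0 < alpha < 1. *)
Definition complete_quotient alpha (k : nat) : R :=
  iter k (fun y => (y - (Num.floor y)%:~R)^-1) alpha.

Definition partial_quotient alpha (k : nat) : int :=
  Num.floor (complete_quotient alpha k).

Definition bounded_partial_quotients alpha : Prop :=
  exists M : nat, forall k, `|partial_quotient alpha k| <= M%:Z.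

End sturmian.

(* Main.v *)
Require Import Defs.
From mathcomp Require Import all_boot all_order all_algebra.
From mathcomp Require Import all_classical all_reals all_analysis.
From mathcomp Require Import ring lra zify.
Set Implicit Arguments.
Unset Strict Implicit.
Unset Printing Implicit Defensive.
Import Order.TTheory GRing.Theory Num.Theory.
Local Open Scope classical_set_scope.
Local Open Scope ring_scope.

(* The letter at time n of the orbit of t is
   floor (t + (n+1) alpha) - floor (t + n alpha), so two points have the same
   coding of length N iff floor (z + k alpha) - floor z agree for all k <= N.

   Let p_k/q_k be the convergents and e_k = |q_k alpha - p_k|.

   If the partial quotients are at most M and q_j <= N < q_(j+1), then two
   boundaries of the partition into words of length N are at distance at least
   e_j >= e_(j+1) + e_(j+2). Since q_(j+1) alpha and q_(j+2) alpha move points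
   in opposite directions by e_(j+1) and e_(j+2), one of these two shifts stays
   in the cell of the word: it returns after at most
   q_(j+2) <= (M+1)^2 q_j <= (M+1)^2 N steps.

   Conversely, with constant K, some word of length q = q_k has a cell of
   length e_k, and by minimality every point of the circle enters it within
   K q_k steps, so that (K+2) q_k e_k > 1. As e_k q_(k+1) <= 1, this gives
   q_(k+1) < (K+2) q_k and bounds the partial quotients. *)

(** * Occurrences and return words in two-sided sequences *)

Section words.
Variable A : finType.
Implicit Types (x : int -> A) (u v w : seq A) (n m : int).

Definition window x n (k : nat) : seq A := mkseq (fun i => x (n + i%:Z)) k.

Lemma eq_window x y n m k :
  window x n k = window y m k <->
  forall i : nat, (i < k)%N -> x (n + i%:Z) = y (m + i%:Z).
Proof.
split=> [e i ik|e]; last first.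
  by apply/eq_in_map => i; rewrite mem_iota add0n => /andP[_ /e].
by have := congr1 (nth (x 0) ^~ i) e; rewrite !nth_mkseq.
Qed.

Lemma window_cat x n (k l : nat) :
  window x n (k + l) = window x n k ++ window x (n + k%:Z) l.
Proof.
rewrite /window /mkseq iotaD map_cat; congr (_ ++ _).
rewrite add0n -[in iota k l](addn0 k) iotaDl -map_comp.
by apply: eq_map => i /=; rewrite PoszD addrA.
Qed.

Lemma window_sub x n (k l i : nat) : (i + k <= l)%N ->
  take k (drop i (window x n l)) = window x (n + i%:Z) k.
Proof.
move=> ikl; rewrite -(subnKC ikl) -addnA !window_cat.
by rewrite drop_size_cat ?size_mkseq// take_size_cat ?size_mkseq.
Qed.

Lemma prefix_occurs x u v n (i : nat) : occurs_at x v n ->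
  (i + size u <= size v)%N ->
  prefix u (drop i v) = (u == window x (n + i%:Z) (size u)).
Proof.
move=> vE le; rewrite prefixE eq_sym.
by rewrite [in LHS]vE -/(window _ _ _) window_sub.
Qed.

Lemma occurs_cat x w u n :
  occurs_at x (w ++ u) n -> occurs_at x u (n + (size w)%:Z).
Proof.
rewrite /occurs_at -/(window _ _ _) size_cat window_cat => /eqP.
by rewrite eqseq_cat ?size_mkseq// => /andP[_ /eqP].
Qed.

Lemma nb_occurrencesE x w u n : occurs_at x (w ++ u) n ->
  nb_occurrences u (w ++ u) =
  count (fun i : nat => u == window x (n + i%:Z) (size u)) (iota 0 (size w).+1).
Proof.
move=> occ; rewrite /nb_occurrences size_cat addnK; apply: eq_in_count => i.
rewrite mem_iota /= add0n ltnS => iw; apply: prefix_occurs => //.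
by rewrite size_cat leq_add2r.
Qed.

Lemma return_word_gap x u w n (r : nat) :
  return_word x u w -> occurs_at x (w ++ u) n -> (0 < r)%N ->
  occurs_at x u (n + r%:Z) -> (size w <= r)%N.
Proof.
move=> [_ pu nb2] occ r0 occr; rewrite leqNgt; apply/negP => rw.
move: nb2; rewrite (nb_occurrencesE occ) -size_filter.
(* If [r < size w], then [0], [r] and [size w] are three distinct positions of [u] in [w ++ u],
   against a count of two. *)
suff /uniq_leq_size : {subset [:: 0; r; size w]%N <=
    [seq i <- iota 0 (size w).+1 | u == window x (n + i%:Z) (size u)]}.
  move=> /[swap] ->; rewrite /= !inE; lia.
move=> i; rewrite !inE mem_filter mem_iota /= => /or3P[] /eqP ->.
- rewrite addr0 andbT; move: pu; rewrite -{1}(drop0 (w ++ u)).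
  by rewrite (prefix_occurs (x := x) (n := n))// ?addr0// size_cat leq_addl.
- by rewrite add0n ltnS (ltnW rw) andbT; apply/eqP.
- by rewrite add0n ltnSn andbT; apply/eqP; exact: occurs_cat.
Qed.

(** Uniform recurrence provides a last occurrence of [u] starting at or before [n] and a first one
    starting after [n]. The word between these two starts is a return word, so its length bounds the
    waiting time from [n]. *)
Lemma language_return_bound x K u : linearly_recurrent_with K x ->
  u != [::] -> language x u ->
  forall n, exists2 k : nat, (k <= K * size u)%N & occurs_at x u (n + k%:Z).
Proof.
move=> [urx lrx] u0 lu n; have [n0 un0] := lu; have [B recB] := urx u lu.
have [m0 m0n um0] : exists2 m, m <= n & occurs_at x u m.
  have [k] : exists k : nat, n0 - k%:Z <= n by exists `|n0 - n|%N; lia.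
  elim: k n0 un0 => [|k IH] n0 un0 le; first by exists n0 => //; lia.
  have [_ [m /andP[_ mn0] um]] := recB _ un0.
  by apply: (IH m um); lia.
have [m1 nm1 um1] : exists2 m, n < m & occurs_at x u m.
  have [k] : exists k : nat, n < n0 + k%:Z by exists `|n0 - n|.+1%N; lia.
  elim: k n0 un0 => [|k IH] n0 un0 le; first by exists n0 => //; lia.
  have [[m /andP[mn0 _] um] _] := recB _ un0.
  by apply: (IH m um); lia.
have exj : exists j : nat, u == window x (n - j%:Z) (size u).
  by exists `|n - m0|%N; apply/eqP; rewrite [LHS]um0; congr (window x _ _); lia.
have exk : exists k : nat, u == window x (n + k.+1%:Z) (size u).
  exists `|m1 - n|.-1%N; apply/eqP; rewrite [LHS]um1.
  by congr (window x _ _); lia.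
case: (ex_minnP exj) => j /eqP uj jmin; case: (ex_minnP exk) => k /eqP uk kmin.
exists k.+1; last exact: uk.
pose w := window x (n - j%:Z) (j + k.+1).
have sw : size w = (j + k.+1)%N by rewrite size_mkseq.
have occ : occurs_at x (w ++ u) (n - j%:Z).
  rewrite /occurs_at size_cat sw -/(window _ _ _) window_cat -/w; congr (w ++ _).
  by rewrite [LHS]uk; congr (window x _ _); lia.
suff rw : return_word x u w.
  by apply: leq_trans (lrx u w u0 lu rw); rewrite sw leq_addl.
split; first by exists (n - j%:Z).
  rewrite -(drop0 (w ++ u)) (prefix_occurs (x := x) (n := n - j%:Z))//.
    by rewrite addr0; apply/eqP.
  by rewrite size_cat leq_addl.
rewrite (nb_occurrencesE occ) sw.
(* The positions split into the first, the interior and the last; an interior occurrence would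
   contradict the minimality of [j] or of [k]. *)
have -> : (j + k.+1).+1 = (1 + (j + k + 1))%N by lia.
rewrite iotaD (iotaD _ (j + k)) !count_cat /= addr0.
rewrite -[in window x (n - j%:Z) _]uj.
rewrite (_ : n - j%:Z + _ = n + k.+1%:Z); last by lia.
rewrite -[in window x (n + k.+1%:Z) _]uk eqxx.
rewrite (_ : count _ _ = 0%N)//; apply/eqP; rewrite -leqn0 leqNgt -has_count.
apply/hasPn => i; rewrite mem_iota => /andP[i0 ijk]; apply/negP => ui.
have [ij|ji] := leqP i j.
  have := jmin (j - i)%N; rewrite (_ : n - (j - i)%N%:Z = n - j%:Z + i%:Z); last by lia.
  by move=> /(_ ui); lia.
have := kmin (i - j).-1%N.
rewrite (_ : n + (i - j).-1.+1%:Z = n - j%:Z + i%:Z); last by lia.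
by move=> /(_ ui); lia.
Qed.

End words.

(** * Convergents of [alpha] and best approximation *)

Section continued_fraction.
Context {R : realType}.
Variable alpha : R.
Hypothesis alpha01 : 0 < alpha < 1.
Hypothesis alpha_irr : irrational alpha.

Definition cf_coef (k : nat) : nat := `|partial_quotient alpha k|%N.

(* Indices are shifted by one: [cf_den k.+1] and [cf_num k.+1] are the usual
   q_k and p_k. *)
Fixpoint convergent_pair (c0 c1 : nat) (k : nat) : nat * nat :=
  if k is k'.+1 then
    let: (c, c') := convergent_pair c0 c1 k' in (c', (cf_coef k * c' + c)%N)
  else (c0, c1).

Definition cf_den k := (convergent_pair 0 1 k).1.
Definition cf_num k := (convergent_pair 1 0 k).1.

Lemma convergent_pairS c0 c1 k :
  (convergent_pair c0 c1 k).2 = (convergent_pair c0 c1 k.+1).1.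
Proof. by rewrite /=; case: convergent_pair. Qed.

Lemma convergent_pairSS c0 c1 k :
  (convergent_pair c0 c1 k.+2).1 =
  (cf_coef k.+1 * (convergent_pair c0 c1 k.+1).1 + (convergent_pair c0 c1 k).1)%N.
Proof. by rewrite -convergent_pairS /=; case: convergent_pair. Qed.

Definition cf_diff k : R := (cf_den k)%:R * alpha - (cf_num k)%:R.

Lemma cf_denSS k : cf_den k.+2 = (cf_coef k.+1 * cf_den k.+1 + cf_den k)%N.
Proof. exact: convergent_pairSS. Qed.

Lemma cf_numSS k : cf_num k.+2 = (cf_coef k.+1 * cf_num k.+1 + cf_num k)%N.
Proof. exact: convergent_pairSS. Qed.

Lemma cf_diffSS k : cf_diff k.+2 = (cf_coef k.+1)%:R * cf_diff k.+1 + cf_diff k.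
Proof. by rewrite /cf_diff cf_denSS cf_numSS !natrD !natrM; ring. Qed.

Lemma irrational_neq (d g : int) : d != 0 -> d%:~R * alpha != g%:~R.
Proof.
move=> d0; apply/eqP => e; apply: alpha_irr.
exists (g%:~R / d%:~R) => //=.
rewrite fmorph_div !rmorph_int -e mulrAC divff ?mul1r// intr_eq0//.
Qed.

(* The signs of the [cf_diff k] alternate, so this is the absolute value. *)
Definition cf_err k : R := (-1) ^+ k.+1 * cf_diff k.

Lemma cf_diffE k : cf_diff k = (-1) ^+ k.+1 * cf_err k.
Proof. by rewrite /cf_err mulrA -expr2 sqrr_sign mul1r. Qed.

Lemma cf_errSS k : cf_err k.+2 = cf_err k - (cf_coef k.+1)%:R * cf_err k.+1.
Proof. by rewrite /cf_err cf_diffSS !exprS; ring. Qed.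

Lemma cf_err0 : cf_err 0 = 1.
Proof. by rewrite /cf_err /cf_diff /cf_den /cf_num /= expr1; ring. Qed.

Lemma cf_err1 : cf_err 1 = alpha.
Proof. by rewrite /cf_err /cf_diff /cf_den /cf_num /= sqrrN expr1n; ring. Qed.

Lemma cf_den_gt0_step k : (0 < cf_coef k.+1)%N -> (0 < cf_den k.+1)%N ->
  (0 < cf_den k.+2)%N.
Proof. by move=> a0 q0; rewrite cf_denSS addn_gt0 muln_gt0 a0 q0. Qed.

(** The recursion [cf_errSS] is a Euclidean division: when the complete quotient is the ratio of two
    consecutive errors, its floor is the quotient and the next error is the remainder. Irrationality
    keeps the remainder nonzero. *)
Lemma cf_invariant k : [/\ (0 < cf_den k.+1)%N, 0 < cf_err k.+1 < cf_err k &
   complete_quotient alpha k.+1 = cf_err k / cf_err k.+1].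
Proof.
elim: k => [|k [q0 /andP[e0 e1] yE]].
  split=> //; first by rewrite cf_err0 cf_err1.
  rewrite cf_err0 cf_err1 div1r /complete_quotient /=.
  have -> : Num.floor alpha = 0.
    by apply: floor_def; rewrite add0r; case/andP: alpha01 => /ltW -> ->.
  by rewrite subr0.
have y1 : 1 < complete_quotient alpha k.+1 by rewrite yE ltr_pdivlMr// mul1r.
have fE : Num.floor (complete_quotient alpha k.+1) = (cf_coef k.+1)%:Z.
  rewrite /cf_coef /partial_quotient gez0_abs// floor_ge0; lra.
have a0 : (0 < cf_coef k.+1)%N.
  by rewrite -ltz_nat -fE floor_gt0 ltW.
have q1 := cf_den_gt0_step a0 q0.
have /andP[] := floor_itv (complete_quotient alpha k.+1).
rewrite fE intrD [X in X + _](_ : _ = (cf_coef k.+1)%:R)// mulr1z yE.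
rewrite ler_pdivlMr// ltr_pdivrMr// => l1 l2.
have e2 : cf_err k.+2 != 0.
  rewrite /cf_err mulf_neq0 ?signr_eq0// subr_eq0.
  by apply: (@irrational_neq (cf_den k.+2) (cf_num k.+2)); case: cf_den q1.
have e2p : 0 < cf_err k.+2 by rewrite lt_neqAle eq_sym e2 cf_errSS; lra.
split=> //; first by rewrite e2p cf_errSS; lra.
rewrite (_ : complete_quotient alpha k.+2 = (complete_quotient alpha k.+1 -
  (Num.floor (complete_quotient alpha k.+1))%:~R)^-1)// fE yE cf_errSS.
rewrite [X in _ - X](_ : _ = (cf_coef k.+1)%:R)//.
have e3 : cf_err k - (cf_coef k.+1)%:R * cf_err k.+1 != 0 by rewrite -cf_errSS.
by field; rewrite e3 gt_eqF.
Qed.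

Lemma cf_err_gt0 k : 0 < cf_err k.
Proof.
case: k => [|k]; first by rewrite cf_err0.
by have [_ /andP[]] := cf_invariant k.
Qed.

Lemma cf_den_gt0 k : (0 < cf_den k.+1)%N.
Proof. by have [] := cf_invariant k. Qed.

Lemma complete_quotient_gt1 k : 1 < complete_quotient alpha k.+1.
Proof.
have [_ /andP[e0 e1] ->] := cf_invariant k.
by rewrite ltr_pdivlMr// mul1r.
Qed.

Lemma partial_quotientE k : partial_quotient alpha k.+1 = (cf_coef k.+1)%:Z.
Proof.
rewrite /cf_coef gez0_abs// floor_ge0.
by have := complete_quotient_gt1 k; lra.
Qed.

Lemma cf_coef_gt0 k : (0 < cf_coef k.+1)%N.
Proof.
by rewrite -ltz_nat -partial_quotientE floor_gt0 ltW// complete_quotient_gt1.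
Qed.

Lemma cf_coef0 : cf_coef 0 = 0%N.
Proof.
rewrite /cf_coef /partial_quotient /= (@floor_def _ _ 0)//.
by rewrite add0r; case/andP: alpha01 => /ltW -> ->.
Qed.

Lemma cf_den_le k : (cf_den k <= cf_den k.+1)%N.
Proof.
case: k => // k; rewrite cf_denSS.
by apply: leq_trans (leq_addr _ _); rewrite leq_pmull ?cf_coef_gt0.
Qed.

Lemma cf_den_ge k : (k <= cf_den k.+1)%N.
Proof.
elim: k => // -[|k] IH; first exact: cf_den_gt0.
rewrite cf_denSS; have := cf_den_gt0 k; have := cf_coef_gt0 k.+1; nia.
Qed.

Lemma cf_err_le k : cf_err k.+1 + cf_err k.+2 <= cf_err k.
Proof.
rewrite cf_errSS; have : 1 <= (cf_coef k.+1)%:R :> R.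
  by rewrite ler1n cf_coef_gt0.
have := cf_err_gt0 k.+1; nra.
Qed.

(** The determinant identity for consecutive convergents, in terms of absolute errors: the
    alternating signs make both terms nonnegative, whence [cf_err_den]. *)
Lemma cf_det k :
  cf_err k * (cf_den k.+1)%:R + cf_err k.+1 * (cf_den k)%:R = 1.
Proof.
elim: k => [|k IH]; first by rewrite cf_err0 /cf_den /=; ring.
by rewrite cf_errSS cf_denSS natrD natrM -[RHS]IH; ring.
Qed.

Lemma cf_err_den k : cf_err k * (cf_den k.+1)%:R <= 1.
Proof.
by rewrite -[leRHS](cf_det k) lerDl mulr_ge0// ltW// cf_err_gt0.
Qed.

(** Since the determinant is 1 or -1, two consecutive convergents form a basis of the integer pairs,
    as [best_approximation] requires. *)
Lemma cf_det_int k :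
  (cf_den k.+1)%:Z * (cf_num k)%:Z - (cf_den k)%:Z * (cf_num k.+1)%:Z
  = (-1) ^+ k :> int.
Proof.
elim: k => [|k IH]; first by [].
by rewrite exprS -IH cf_denSS cf_numSS !PoszD !PoszM; ring.
Qed.

(* Write (d, g) = a (q_k, p_k) + b (q_(k+1), p_(k+1)) with a, b integers. As
   |d| < q_(k+1), a is nonzero and a, b do not have the same sign, so that the
   two contributions to d alpha - g add up in absolute value. *)
Lemma best_approximation k (d g : int) : (`|d| < cf_den k.+1)%N ->
  (d, g) != (0, 0) -> cf_err k <= `|d%:~R * alpha - g%:~R|.
Proof.
move=> dq dg0.
pose q0 := (cf_den k)%:Z; pose p0 := (cf_num k)%:Z.
pose q1 := (cf_den k.+1)%:Z; pose p1 := (cf_num k.+1)%:Z.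
pose s : int := (-1) ^+ k.
have ss : s * s = 1 by rewrite /s -expr2 sqrr_sign.
have det : q1 * p0 - q0 * p1 = s := cf_det_int k.
(* Cramer's rule: multiplying by [s] amounts to dividing by the determinant [s]. *)
pose a : int := s * (q1 * g - p1 * d); pose b : int := s * (p0 * d - q0 * g).
have dE : d = a * q0 + b * q1.
  by rewrite -[LHS]mul1r -ss -{2}det /a /b; ring.
have gE : g = a * p0 + b * p1.
  by rewrite -[LHS]mul1r -ss -{2}det /a /b; ring.
have DE : d%:~R * alpha - g%:~R =
    (-1) ^+ k.+1 * (a%:~R * cf_err k - b%:~R * cf_err k.+1).
  transitivity (a%:~R * cf_diff k + b%:~R * cf_diff k.+1).
    by rewrite dE gE !intrD !intrM /cf_diff /q0 /q1 /p0 /p1; ring.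
  by rewrite !cf_diffE !exprS; ring.
rewrite DE normrM normrX normrN1 expr1n mul1r.
have e0 := cf_err_gt0 k; have e1 := cf_err_gt0 k.+1.
have q10 : 0 < q1 by rewrite /q1 ltz_nat cf_den_gt0.
have q00 : 0 <= q0 by [].
have dq' : - q1 < d < q1 by move: dq; rewrite /q1; lia.
have q1b : 0 < b -> q1 <= b * q1 by move=> b0; apply: ler_peMl; lia.
have bq1 : b < 0 -> b * q1 <= - q1.
  by move=> b0; rewrite lerNr -mulNr; apply: ler_peMl; lia.
have a0 : a != 0.
  apply/eqP => a0; move: dE gE; rewrite a0 !mul0r !add0r => dE gE.
  have b0 : b = 0 by lia.
  by move: dg0; rewrite dE gE b0 !mul0r eqxx.
have [ap|an] : 0 < a \/ a < 0 by lia.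
  have b0 : b <= 0 by have := mulr_ge0 (ltW ap) q00; lia.
  rewrite ger0_norm; last first.
    rewrite subr_ge0 (@le_trans _ _ 0)//; last by rewrite mulr_ge0 ?ler0z// ltW.
    by rewrite mulr_le0_ge0 ?lerz0// ltW.
  have a1 : 0 <= (a%:~R - 1) * cf_err k.
    by apply: mulr_ge0; [rewrite subr_ge0 ler1z; lia|exact: ltW].
  have b1 : b%:~R * cf_err k.+1 <= 0 by rewrite mulr_le0_ge0 ?lerz0// ltW.
  lra.
have b0 : 0 <= b by have := mulr_le0_ge0 (ltW an) q00; lia.
rewrite ler0_norm; last first.
  rewrite subr_le0 (@le_trans _ _ 0)//; last by rewrite mulr_ge0 ?ler0z// ltW.
  by rewrite mulr_le0_ge0 ?lerz0// ltW.
have a1 : (a%:~R + 1) * cf_err k <= 0.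
  apply: mulr_le0_ge0; last exact: ltW.
  by rewrite -[1](mulr1z 1) -intrD lerz0; lia.
have b1 : 0 <= b%:~R * cf_err k.+1 by rewrite mulr_ge0 ?ler0z// ltW.
lra.
Qed.

End continued_fraction.

(** * Product topology, orbits and minimality *)

Section topology.
Implicit Types (x y : biseq) (Z : set biseq).

Lemma nbhs_agree x (N : nat) :
  nbhs x [set y : biseq | forall i : int, `|i| <= N%:Z -> y i = x i].
Proof.
have [s sP] : exists s : seq int, forall i : int, `|i| <= N%:Z -> i \in s.
  exists ([seq k%:Z | k <- iota 0 N.+1] ++ [seq - k%:Z | k <- iota 0 N.+1]).
  move=> i iN; rewrite mem_cat; apply/orP.
  have [i0|i0] := leP 0 i; [left|right]; apply/mapP; exists `|i|%N.
  - by rewrite mem_iota; lia.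
  - by lia.
  - by rewrite mem_iota; lia.
  - by lia.
apply: (@filterS _ (nbhs x) _ [set y : biseq | forall i, i \in s -> y i = x i]).
  by move=> y /= xy i /sP; exact: xy.
elim: s {sP} => [|i s IH]; first by apply: filterE.
have ni : nbhs x [set y : biseq | y i = x i].
  exact: (@proj_continuous int (fun=> bool) i x [set x i] (discrete_set1 _)).
apply: filterS2 ni IH => y /= yi ys j; rewrite inE => /predU1P[->//|]; exact: ys.
Qed.

Lemma closed_agree Z x : closed Z ->
  (forall N : nat, exists y, Z y /\ forall i : int, `|i| <= N%:Z -> y i = x i) ->
  Z x.
Proof.
move=> cZ /choice[y yP].
apply: (@closed_cvg _ _ \oo _ y Z cZ); first by apply: nearW => n; have [] := yP n.
apply/cvg_sup => n; apply/cvg_image.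
  by apply/seteqP; split=> // b _; exists (fun=> b).
move=> B nB; exists ((fun z : biseq => z n) @^-1` B); last first.
  by apply/seteqP; split=> [b [z Bz <-]//|b Bb]; exists (fun=> b).
(* Coordinate [n] of [y k] is that of [x] as soon as [k] is at least [|n|]. *)
exists `|n|%N => // k /= nk; rewrite (yP k).2; first exact: nbhs_singleton nB.
lia.
Qed.

Lemma shift_points (X : subshift) x (n : int) : points X x ->
  points X (fun i => x (i + n)).
Proof.
move=> Xx.
have fwd (k : nat) : points X (fun i => x (i + k%:Z)).
  elim: k => [|k IH]; first by under eq_fun do rewrite addr0.
  rewrite -(@subshift_invariant X); exists (fun i => x (i + k%:Z)) => //.
  by apply/funext => i; rewrite /left_shift; congr x; lia.
have bwd (k : nat) : points X (fun i => x (i - k%:Z)).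
  elim: k => [|k IH]; first by under eq_fun do rewrite subr0.
  (* Backward shifts use the other inclusion of the invariance: the point is the shift of some [z]
     in [X]. *)
  move: IH; rewrite -{1}(@subshift_invariant X) => -[z Xz ze].
  suff -> : (fun i => x (i - k.+1%:Z)) = z by [].
  apply/funext => i; have := congr1 (fun f : biseq => f (i - 1)) ze.
  by rewrite /left_shift subrK => ->; congr x; lia.
by case: n => k; [exact: fwd | rewrite NegzE; exact: bwd].
Qed.

(** The closure of the orbit of [x] is a subshift inside [X], hence all of [X], so the orbit meets
    every neighbourhood of [y]. *)
Lemma minimal_agree (X : subshift) x y (N : nat) : minimal X ->
  points X x -> points X y ->
  exists m : int, forall i : int, `|i| <= N%:Z -> x (i + m) = y i.
Proof.
move=> minX Xx Xy.
pose O : set biseq := [set z | exists m : int, z = (fun i => x (i + m))].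
have sO : left_shift @` O = O.
  apply/seteqP; split=> [_ [_ [m ->] <-]|_ [m ->]].
    by exists (m + 1); apply/funext => i; rewrite /left_shift addrAC addrA.
  exists (fun i => x (i + (m - 1))); first by exists (m - 1).
  by apply/funext => i; rewrite /left_shift; congr x; lia.
pose Y := Subshift (@closed_closure _ O) (shift_closure sO).
have YX : points Y = points X.
  apply: minX => [z|]; last by exists x; apply: subset_closure; exists 0;
    under eq_fun do rewrite addr0.
  move/(closure_subset (B := points X)) => H.
  rewrite ((closure_id _).1 (@subshift_closed X)); apply: H.
  by move=> _ [m ->]; exact: shift_points.
have : points Y y by rewrite YX.
move=> /(_ _ (@nbhs_agree y N)) [z [[m ->] H]].
by exists m.
Qed.

End topology.

(** * Codings as increments of floors *)

Section coding.
Context {R : realType}.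
Variable alpha : R.
Hypothesis alpha01 : 0 < alpha < 1.
Implicit Types (t z : R) (n : int).

Lemma floorD_intr z n : Num.floor (z + n%:~R) = Num.floor z + n.
Proof. by rewrite floorDrz ?intr_int// intrKfloor. Qed.

(** The letter read on the real line: it is 1 when an integer lies in []z, z + alpha]]. This avoids
    reducing modulo 1, at the price of the periodicity [crossesDz]. *)
Definition crosses z : bool := Num.floor (z + alpha) != Num.floor z.

Lemma floor_crosses z :
  Num.floor (z + alpha) = Num.floor z + (crosses z)%:Z.
Proof.
rewrite /crosses; have /andP[a0 a1] := alpha01.
have /andP[f1] := floor_itv z; rewrite intrD mulr1z => f2.
have [e|ne] := eqVneq; first by rewrite addr0.
apply: floor_def; rewrite !intrD !mulr1z.
apply/andP; split; last by lra.
rewrite leNgt; apply/negP => zlt; move/eqP: ne; apply; apply: floor_def.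
by rewrite intrD mulr1z; apply/andP; split; lra.
Qed.

Lemma crossesDz z n : crosses (z + n%:~R) = crosses z.
Proof.
rewrite /crosses addrAC !floorD_intr.
by rewrite (inj_eq (addIr _)).
Qed.

Lemma sturmian_letterE z : sturmian_letter alpha (z - (Num.floor z)%:~R) = crosses z.
Proof.
have /andP[f1] := floor_itv z; rewrite intrD mulr1z => f2.
rewrite /sturmian_letter in_itv /= subr_ge0 f1 /= -leNgt.
have := floor_crosses z; case: crosses => /= e.
  have := floor_le (z + alpha); rewrite e intrD mulr1z => ?; lra.
have := floorD1_gt (z + alpha); rewrite e addr0 intrD mulr1z => ?.
by apply/negbTE; rewrite -ltNge; lra.
Qed.

Lemma iter_rotation (beta : R) t (k : nat) : t \in `[0, 1[ ->
  iter k (rotation beta) t =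
  t + k%:R * beta - (Num.floor (t + k%:R * beta))%:~R.
Proof.
move=> t01; elim: k => [|k IH].
  by rewrite mul0r addr0 /= (@floor_def _ t 0) ?subr0//.
rewrite iterS IH /rotation.
have -> (F : int) : t + k%:R * beta - F%:~R + beta =
    t + k.+1%:R * beta + (- F)%:~R.
  by rewrite mulrNz -addn1 natrD; ring.
by rewrite floorD_intr intrD mulrNz; ring.
Qed.

Lemma sturmian_codingE t n : t \in `[0, 1[ ->
  sturmian_coding alpha t n = crosses (t + n%:~R * alpha).
Proof.
move=> t01; rewrite -sturmian_letterE; congr sturmian_letter.
case: n => k; rewrite /rotation_iter iter_rotation//.
by rewrite NegzE mulrNz mulrN mulNr.
Qed.

Lemma sturmian_coding_frac z n :
  sturmian_coding alpha (z - (Num.floor z)%:~R) n = crosses (z + n%:~R * alpha).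
Proof.
rewrite sturmian_codingE; last first.
  by have := floor_itv z; rewrite in_itv /= intrD mulr1z => /andP[? ?]; lra.
by rewrite addrAC -mulrNz crossesDz.
Qed.

(** Each letter is one increment of the floor along the orbit, so equal letters and equal partial
    sums determine each other. *)
Lemma eq_crossesP z z' (N : nat) :
  (forall i : nat, (i < N)%N ->
     crosses (z + i%:R * alpha) = crosses (z' + i%:R * alpha)) <->
  (forall k : nat, (k <= N)%N ->
     Num.floor (z + k%:R * alpha) - Num.floor z =
     Num.floor (z' + k%:R * alpha) - Num.floor z').
Proof.
have stepE y k : y + k.+1%:R * alpha = y + k%:R * alpha + alpha.
  by rewrite -addn1 natrD mulrDl mul1r addrA.
split=> [e|e i iN].
  elim=> [_|k IH kN]; first by rewrite !mul0r !addr0 !subrr.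
  by rewrite !stepE !floor_crosses e// addrAC IH 1?ltnW// addrAC.
have := e i.+1 iN; rewrite !stepE !floor_crosses addrAC (e i (ltnW iN)) addrAC.
by move=> /addIr/addrI; do 2 case: crosses.
Qed.

(** Right continuity of the floor at finitely many points. Cells are half-open, so [z] may be the
    left end of its cell and only a right neighbourhood is available. *)
Lemma floors_stable_right z (N : nat) : exists2 eta : R, 0 < eta &
  forall y, z <= y < z + eta -> forall k : nat, (k <= N)%N ->
  Num.floor (y + k%:R * alpha) = Num.floor (z + k%:R * alpha).
Proof.
elim: N => [|N [eta eta0 IH]].
  pose eta := (Num.floor z + 1)%:~R - z.
  exists eta => [|y]; first by rewrite subr_gt0 floorD1_gt.
  rewrite /eta => /andP[y1 y2] k; rewrite leqn0 => /eqP ->.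
  rewrite mul0r !addr0; apply: floor_def.
  by have := floor_le z; lra.
pose w := z + N.+1%:R * alpha; pose eta' := (Num.floor w + 1)%:~R - w.
exists (Num.min eta eta') => [|y /andP[y1]].
  by rewrite lt_min eta0 subr_gt0 floorD1_gt.
rewrite -ltrBlDl lt_min => /andP[y2 y3] k; rewrite leq_eqVlt => /predU1P[->|].
  by apply: floor_def; move: y3; rewrite /eta' /w; have := floor_le w; rewrite /w; lra.
by rewrite ltnS; apply: IH; rewrite y1 -ltrBlDl.
Qed.

End coding.

(** * Bounded partial quotients imply linear recurrence *)

Section bounded_to_recurrent.
Context {R : realType}.
Variable alpha : R.
Hypothesis alpha01 : 0 < alpha < 1.
Hypothesis alpha_irr : irrational alpha.
Implicit Types (t z : R) (n : int).

(* If both shifts crossed an integer, the two crossed boundaries would be at a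
   distance |d alpha - g| < e + e' with |d| <= N, contradicting
   best_approximation. *)
Lemma shifts_stable z (N j : nat) (e e' : R) :
  0 < e -> 0 < e' -> e + e' <= cf_err alpha j ->
  (N < cf_den alpha j.+1)%N ->
  (forall k : nat, (k <= N)%N ->
     Num.floor (z + e + k%:R * alpha) = Num.floor (z + k%:R * alpha)) \/
  (forall k : nat, (k <= N)%N ->
     Num.floor (z - e' + k%:R * alpha) = Num.floor (z + k%:R * alpha)).
Proof.
move=> e0 e'0 ee Nq; apply: contrapT => /not_orP[].
move=> /existsNP[k /not_implyP[kN /eqP fk]] /existsNP[l /not_implyP[lN /eqP fl]].
have fk' : Num.floor (z + k%:R * alpha) + 1 <= Num.floor (z + e + k%:R * alpha).
  have : Num.floor (z + k%:R * alpha) <= Num.floor (z + e + k%:R * alpha).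
    by apply: le_floor; lra.
  by move: fk; lia.
have fl' : Num.floor (z - e' + l%:R * alpha) + 1 <= Num.floor (z + l%:R * alpha).
  have : Num.floor (z - e' + l%:R * alpha) <= Num.floor (z + l%:R * alpha).
    by apply: le_floor; lra.
  by move: fl; lia.
(* The shift to the right crosses the boundary [floor (z + k alpha) + 1 - k alpha], the shift to the
   left crosses [floor (z + l alpha) - l alpha]; their difference is [g - d alpha]. *)
pose g := Num.floor (z + k%:R * alpha) + 1 - Num.floor (z + l%:R * alpha).
pose d := k%:Z - l%:Z.
have gE : g%:~R = (Num.floor (z + k%:R * alpha))%:~R + 1
    - (Num.floor (z + l%:R * alpha))%:~R :> R.
  by rewrite /g intrB intrD.
have dE : d%:~R = k%:R - l%:R :> R by rewrite /d intrB.
have := floorD1_gt (z + k%:R * alpha); rewrite intrD mulr1z => k1.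
have l1 := floor_le (z + l%:R * alpha).
have k2 : (Num.floor (z + k%:R * alpha))%:~R + 1 <= z + e + k%:R * alpha.
  by rewrite -[1](mulr1z 1) -intrD -floor_ge_int.
have l2 : z - e' + l%:R * alpha < (Num.floor (z + l%:R * alpha))%:~R.
  by rewrite -floor_lt_int -lezD1.
have gd : 0 < g%:~R - d%:~R * alpha < e + e'.
  by rewrite gE dE mulrBl; apply/andP; split; lra.
have : cf_err alpha j <= `|d%:~R * alpha - g%:~R|.
  apply: (best_approximation alpha01 alpha_irr); first by rewrite /d; clear -kN lN Nq; lia.
  by apply: contraTneq gd => -[-> ->]; rewrite mul0r subrr ltxx.
rewrite distrC ger0_norm; lra.
Qed.

(** Modulo 1, the rotations by [cf_den j.+1] and [cf_den j.+2] steps are translations in opposite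
    directions, of lengths that add up to at most [cf_err j], so [shifts_stable] keeps one of them
    in the cell of the word. Going back in time swaps the directions. *)
Lemma window_return z (N j : nat) : (N < cf_den alpha j.+1)%N ->
  (exists2 r : nat, (0 < r <= cf_den alpha j.+2)%N & forall i : nat, (i < N)%N ->
    crosses alpha (z + r%:R * alpha + i%:R * alpha) = crosses alpha (z + i%:R * alpha)) /\
  (exists2 r : nat, (0 < r <= cf_den alpha j.+2)%N & forall i : nat, (i < N)%N ->
    crosses alpha (z - r%:R * alpha + i%:R * alpha) = crosses alpha (z + i%:R * alpha)).
Proof.
move=> Nq.
have e1 := cf_err_gt0 alpha01 alpha_irr j.+1.
have e2 := cf_err_gt0 alpha01 alpha_irr j.+2.
have e12 := cf_err_le alpha01 alpha_irr j.
have q1 := cf_den_gt0 alpha01 alpha_irr j.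
have q2 := cf_den_gt0 alpha01 alpha_irr j.+1.
have q12 := cf_den_le alpha01 alpha_irr j.+1.
have crE y y' : (forall k : nat, (k <= N)%N ->
     Num.floor (y + k%:R * alpha) = Num.floor (y' + k%:R * alpha)) ->
  forall i : nat, (i < N)%N ->
    crosses alpha (y + i%:R * alpha) = crosses alpha (y' + i%:R * alpha).
  move=> H; apply/(eq_crossesP alpha01) => k kN.
  by rewrite H//; have := H 0%N isT; rewrite !mul0r !addr0 => ->.
have fwd m i : crosses alpha (z + (cf_den alpha m)%:R * alpha + i%:R * alpha) =
    crosses alpha (z + cf_diff alpha m + i%:R * alpha).
  rewrite -(crossesDz _ _ (- (cf_num alpha m)%:Z)); congr crosses.
  by rewrite /cf_diff mulrNz; ring.
have bwd m i : crosses alpha (z - (cf_den alpha m)%:R * alpha + i%:R * alpha) =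
    crosses alpha (z - cf_diff alpha m + i%:R * alpha).
  rewrite -(crossesDz _ _ (cf_num alpha m)%:Z); congr crosses.
  by rewrite /cf_diff; ring.
have e21 : cf_err alpha j.+2 + cf_err alpha j.+1 <= cf_err alpha j by rewrite addrC.
have S12 := shifts_stable z e1 e2 e12 Nq.
have S21 := shifts_stable z e2 e1 e21 Nq.
have sgn : (-1) ^+ j.+3 = - (-1) ^+ j.+2 :> R by rewrite exprS mulN1r.
have D1 := cf_diffE alpha j.+1; have D2 := cf_diffE alpha j.+2; rewrite sgn in D2.
(* The parity of [j] decides which of the two translations goes to the right. *)
have [s|s] : (-1) ^+ j.+2 = 1 :> R \/ (-1) ^+ j.+2 = -1 :> R.
- by rewrite -signr_odd; case: odd; [right|left]; rewrite ?expr0 ?expr1.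
- rewrite s mul1r in D1; rewrite s mulN1r in D2.
  split; [case: S12 => S|case: S21 => S].
  + by exists (cf_den alpha j.+1); [rewrite q1|move=> i iN; rewrite fwd D1; exact: crE].
  + by exists (cf_den alpha j.+2); [rewrite q2 /=|move=> i iN; rewrite fwd D2; exact: crE].
  + by exists (cf_den alpha j.+2); [rewrite q2 /=|move=> i iN; rewrite bwd D2 opprK; exact: crE].
  + by exists (cf_den alpha j.+1); [rewrite q1|move=> i iN; rewrite bwd D1; exact: crE].
rewrite s mulN1r in D1; rewrite s opprK mul1r in D2.
split; [case: S21 => S|case: S12 => S].
+ by exists (cf_den alpha j.+2); [rewrite q2 /=|move=> i iN; rewrite fwd D2; exact: crE].
+ by exists (cf_den alpha j.+1); [rewrite q1|move=> i iN; rewrite fwd D1; exact: crE].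
+ by exists (cf_den alpha j.+1); [rewrite q1|move=> i iN; rewrite bwd D1 opprK; exact: crE].
+ by exists (cf_den alpha j.+2); [rewrite q2 /=|move=> i iN; rewrite bwd D2; exact: crE].
Qed.

Lemma occurs_coding t (u : seq bool) n m : t \in `[0, 1[ ->
  occurs_at (sturmian_coding alpha t) u n ->
  (forall i : nat, (i < size u)%N ->
    crosses alpha (t + m%:~R * alpha + i%:R * alpha) =
    crosses alpha (t + n%:~R * alpha + i%:R * alpha)) ->
  occurs_at (sturmian_coding alpha t) u m.
Proof.
move=> t01 un H; rewrite /occurs_at [LHS]un; apply/eq_window => i iu.
by rewrite !sturmian_codingE// !intrD !mulrDl !addrA H.
Qed.

Lemma cf_den_gt_ex (N : nat) : exists j : nat, (N < cf_den alpha j.+1)%N.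
Proof. by exists N.+1; exact: cf_den_ge. Qed.

Lemma coding_uniformly_recurrent t : t \in `[0, 1[ ->
  uniformly_recurrent (sturmian_coding alpha t).
Proof.
move=> t01 u _; have [j Nj] := cf_den_gt_ex (size u).
exists (cf_den alpha j.+2) => n un.
have [[r /andP[r0 rj] H] [r' /andP[r'0 r'j] H']] :=
  window_return (t + n%:~R * alpha) Nj.
split.
  exists (n + r%:Z); first by lia.
  apply: (occurs_coding t01 un) => i iu.
  by rewrite intrD mulrDl addrA H.
exists (n - r'%:Z); first by lia.
apply: (occurs_coding t01 un) => i iu.
by rewrite intrB mulrBl addrA H'.
Qed.

Lemma coding_linearly_recurrent t (M : nat) : t \in `[0, 1[ ->
  (forall k, (cf_coef alpha k <= M)%N) ->
  linearly_recurrent_with (M.+1 ^ 2) (sturmian_coding alpha t).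
Proof.
move=> t01 aM; split; first exact: coding_uniformly_recurrent.
move=> u w u0 _ rw; have [[n wun] pu _] := rw.
have un : occurs_at (sturmian_coding alpha t) u n.
  move: pu; rewrite -{1}(drop0 (w ++ u)) (prefix_occurs wun) ?addr0//.
    by move/eqP.
  by rewrite size_cat leq_addl.
have su : (0 < size u)%N by case: (u) u0.
(* The least index is not 0, because [cf_den 1] is 1 and [u] is not empty; its predecessor then
   bounds [size u] from below. *)
case: (ex_minnP (cf_den_gt_ex (size u))) => -[|j] uj jmin.
  by move: uj; rewrite /cf_den /= ltnS leqn0 => /eqP e; rewrite e in su.
have ju : (cf_den alpha j.+1 <= size u)%N.
  by rewrite leqNgt; apply/negP => /jmin; rewrite ltnn.
(* Two such steps lead from [cf_den j.+1] to [cf_den j.+3], hence the square in the constant. *)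
have step k : (cf_den alpha k.+2 <= M.+1 * cf_den alpha k.+1)%N.
  rewrite cf_denSS mulSn addnC leq_add ?cf_den_le//.
  by rewrite leq_mul2r aM orbT.
have [[r /andP[r0 rj] H] _] :=
  window_return (t + n%:~R * alpha) uj.
apply: (@leq_trans r); last first.
  apply: leq_trans rj _; apply: leq_trans (step _) _.
  rewrite expnS expn1 -mulnA leq_mul2l /=; apply: leq_trans (step _) _.
  by rewrite leq_mul2l /=.
apply: (return_word_gap rw wun r0); apply: (occurs_coding t01 un) => i iu.
by rewrite intrD mulrDl addrA H.
Qed.

(** Odd indices give positive differences, which [cf_err_den] and [cf_den_ge] make small. *)
Lemma cf_diff_small (eta : R) : 0 < eta ->
  exists k, 0 < cf_diff alpha k < eta.
Proof.
move=> eta0; pose k := Num.bound eta^-1.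
have bk : eta^-1 < k%:R by apply: archi_boundP; rewrite invr_ge0 ltW.
exists k.*2.+1.
have -> : cf_diff alpha k.*2.+1 = cf_err alpha k.*2.+1.
  by rewrite /cf_err -signr_odd /= odd_double mul1r.
have e0 := cf_err_gt0 alpha01 alpha_irr k.*2.+1.
rewrite e0 /=; have := cf_err_den alpha01 alpha_irr k.*2.+1.
have kq : k%:R <= (cf_den alpha k.*2.+2)%:R :> R.
  by rewrite ler_nat; have := cf_den_ge alpha01 alpha_irr k.*2.+1; lia.
move=> eq1; rewrite ltNge; apply/negP => le.
have : eta * (cf_den alpha k.*2.+2)%:R <= 1.
  by apply: le_trans eq1; rewrite ler_wpM2r.
rewrite leNgt => /negP; apply; rewrite -ltr_pdivrMl// mulr1.
exact: lt_le_trans kq.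
Qed.

(** Iterating a rotation by [D] with [0 < D < eta] cannot jump over [[s, s + eta[], where the word
    is that of [s], and about [1 / D] iterations go once around the circle, from any [z]. *)
Lemma crosses_syndetic (s : R) (N : nat) : exists L : nat, forall z,
  exists2 m : nat, (m <= L)%N & forall i : nat, (i < N)%N ->
    crosses alpha (z + m%:R * alpha + i%:R * alpha) =
    crosses alpha (s + i%:R * alpha).
Proof.
have [eta eta0 etaP] := floors_stable_right alpha s N.
have [k /andP[]] := cf_diff_small eta0.
set D := cf_diff alpha k => D0 Deta.
exists (`|Num.ceil D^-1| * cf_den alpha k)%N => z.
(* The integer translate [z + n] lies in []s - 1, s]], and [v] is its distance to [s] in units of
   [D]; rounding [v] up gives the first multiple of [D] that reaches [s]. *)
pose n := Num.floor (s - z); pose v := (s - z - n%:~R) / D.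
have v0 : 0 <= v by rewrite divr_ge0 ?(ltW D0)// subr_ge0 floor_le.
have vD : v <= D^-1.
  rewrite ler_pdivrMr// mulVf ?gt_eqF//.
  by have := floorD1_gt (s - z); rewrite -/n intrD mulr1z => ?; lra.
have c0 : 0 <= Num.ceil v by rewrite ceil_ge0; lra.
pose j := `|Num.ceil v|%N.
have jE : j%:R = (Num.ceil v)%:~R :> R by rewrite -[in RHS](gez0_abs c0).
have /andP[v1 v2] := ceil_itv v; rewrite intrB mulr1z -jE in v1.
rewrite -jE in v2.
exists (j * cf_den alpha k)%N.
  rewrite leq_mul2r; apply/orP; right.
  by move: c0 (le_ceil vD); rewrite /j; clear; lia.
pose y := z + n%:~R + j%:R * D.
have ys : s <= y < s + eta.
  have : (s - z - n%:~R) <= j%:R * D by rewrite -ler_pdivrMr.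
  have : (j%:R - 1) * D < (s - z - n%:~R) by rewrite -ltr_pdivlMr.
  by rewrite /y => ? ?; apply/andP; split; lra.
move=> i iN; transitivity (crosses alpha (y + i%:R * alpha)).
  rewrite -(crossesDz _ _ (n - (j * cf_num alpha k)%N%:Z)); congr crosses.
  rewrite intrB (_ : (_ * _)%N%:Z%:~R = j%:R * (cf_num alpha k)%:R); last first.
    by rewrite -natrM.
  by rewrite /y /D /cf_diff natrM; ring.
move: i iN; apply/(eq_crossesP alpha01) => l lN.
rewrite etaP//; have := etaP _ ys 0%N isT.
by rewrite !mul0r !addr0 => ->.
Qed.

Lemma sturmian_coding_in t : t \in `[0, 1[ ->
  points (sturmian_subshift alpha) (sturmian_coding alpha t).
Proof. by move=> t01; apply: subset_closure; exists t. Qed.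

(** As [Y] is closed, it suffices to approximate each coding by shifts of one point [y] of [Y]. On a
    long window [y] agrees with some coding, in which [crosses_syndetic] finds the required word. *)
Lemma sturmian_minimal : minimal (sturmian_subshift alpha).
Proof.
move=> Y YX [y Yy]; apply/seteqP; split=> // x Xx.
have cY := @subshift_closed Y; rewrite ((closure_id _).1 cY).
move: x Xx; apply: closure_subset => _ [t /= t01 <-].
apply: (closed_agree cY) => N.
(* Starting from [t - N alpha], a word of length [2N + 1] covers the times from [-N] to [N]. *)
have [L LP] := crosses_syndetic (t - N%:R * alpha) (N + N).+1.
(* The word occupies the times from [m] to [m + 2N] with [m <= L], hence this radius. *)
have [_ [[t' t'01 <-] /= yt']] := YX y Yy _ (@nbhs_agree y (L + (N + N))).
have [m mL mP] := LP t'.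
exists (fun i => y (i + (m + N)%N%:Z)); split; first exact: shift_points.
move=> i iN.
have [k kE] : exists k : nat, i + N%:Z = k%:Z by exists (absz (i + N%:Z)); lia.
rewrite -yt'; last by lia.
rewrite !sturmian_codingE//.
have -> : i = k%:Z - N%:Z by lia.
have := mP k; rewrite (_ : t - _ + _ = t + (k%:Z - N%:Z)%:~R * alpha); last first.
  by rewrite intrB; ring.
rewrite (_ : t' + _ + _ = t' + (k%:Z - N%:Z + (m + N)%N%:Z)%:~R * alpha); last first.
  by rewrite PoszD !intrD mulrNz; ring.
by apply; lia.
Qed.

Lemma bounded_linearly_recurrent :
  bounded_partial_quotients alpha -> linearly_recurrent (sturmian_subshift alpha).
Proof.
move=> [M pM]; split; first exact: sturmian_minimal.
have t01 : (0 : R) \in `[0, 1[ by rewrite in_itv /= lexx ltr01.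
exists (sturmian_coding alpha 0); first exact: sturmian_coding_in.
by exists (M.+1 ^ 2)%N; exact: coding_linearly_recurrent.
Qed.

End bounded_to_recurrent.

(** * Linear recurrence implies bounded partial quotients *)

Section recurrent_to_bounded.
Context {R : realType}.
Variable alpha : R.
Hypothesis alpha01 : 0 < alpha < 1.
Hypothesis alpha_irr : irrational alpha.
Implicit Types (t z : R) (n : int).

(** The sequence [x] need not be the coding of a point, but by minimality it contains both the word
    of [s] and a long stretch of the coding of [z]; the return bound applies inside that stretch. *)
Lemma linearly_recurrent_cover (x : biseq) K (s : R) (q : nat) :
  minimal (sturmian_subshift alpha) ->
  points (sturmian_subshift alpha) x -> linearly_recurrent_with K x ->
  (0 < q)%N ->
  forall z, exists2 k : nat, (k <= K * q)%N & forall i : nat, (i < q)%N ->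
    crosses alpha (z + k%:R * alpha + i%:R * alpha) =
    crosses alpha (s + i%:R * alpha).
Proof.
move=> minX Xx lrx q0 z.
have Xc t : points (sturmian_subshift alpha)
    (sturmian_coding alpha (t - (Num.floor t)%:~R)).
  apply: subset_closure; exists (t - (Num.floor t)%:~R) => //=.
  by have := floor_itv t; rewrite in_itv /= intrD mulr1z => /andP[? ?]; lra.
have agree t (N : nat) : exists m : int, forall i : nat, (i < N)%N ->
    x (m + i%:Z) = crosses alpha (t + i%:R * alpha).
  have [m mP] := minimal_agree N minX Xx (Xc t).
  exists m => i iN; rewrite addrC mP; last by lia.
  by rewrite sturmian_coding_frac.
have [n0 n0P] := agree s q.
pose u := window x n0 q.
have su : size u = q by rewrite size_mkseq.
have u0 : u != [::] by rewrite -size_eq0 su -lt0n.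
have lu : language x u by exists n0; rewrite /occurs_at su.
(* Long enough to contain a whole word of length [q] starting after at most [K * q] steps. *)
have [m mP] := agree z (K * q + q)%N.
have [k kK uk] := language_return_bound lrx u0 lu m.
rewrite su in kK; exists k => // i iq.
move: uk; rewrite /occurs_at su -/(window _ _ _) => /eq_window /(_ i iq).
rewrite n0P// => ->; rewrite -(addrA m) -PoszD mP; last by lia.
by rewrite natrD mulrDl addrA.
Qed.

(** An arc of the circle; it does not wrap around when [0 <= a] and [a + e <= 1]. *)
Definition in_cell (a e z : R) := a <= z - (Num.floor z)%:~R < a + e.

(* The points coded by some word of length q lie in an interval of length
   |q alpha - p|. *)
Lemma short_cell (q : nat) (p : int) (e : R) : 0 < e < 1 ->
  `|q%:R * alpha - p%:~R| = e ->
  exists s a, [/\ 0 <= a, a + e <= 1 & forall z,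
    (forall i : nat, (i < q)%N -> crosses alpha (z + i%:R * alpha) =
      crosses alpha (s + i%:R * alpha)) -> in_cell a e z].
Proof.
move=> /andP[e0 e1] De.
have [DE|DE] : q%:R * alpha = p%:~R + e \/ q%:R * alpha = p%:~R - e.
- by move: De; case: ler0P => _ <-; [right|left]; ring.
(* The increment of the floor over [q] steps is [p] or [p + 1]; it is [p + 1], as for [s = 1 - e],
   only if the fractional part of [z] is at least [1 - e]. *)
- exists (1 - e), (1 - e); split; [lra|lra|move=> z].
  move=> /(eq_crossesP alpha01) /(_ q (leqnn q)); rewrite DE.
  rewrite (_ : 1 - e + _ = 0 + (1 + p)%:~R); last by rewrite intrD; ring.
  rewrite floorD_intr floor0 (@floor_def _ (1 - e) 0); last first.
    by rewrite add0r; apply/andP; split; lra.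
  rewrite add0r subr0 (_ : z + _ = z + e + p%:~R); last by ring.
  rewrite floorD_intr addrAC => /addIr ze.
  have /andP[z1 z2] := floor_itv z; rewrite intrD mulr1z in z2.
  have := floor_le (z + e); have -> : Num.floor (z + e) = Num.floor z + 1.
    by rewrite -ze [RHS]addrC subrK.
  by rewrite intrD mulr1z => ?; apply/andP; split; lra.
(* Here the increment is [p - 1], as for [s = 0], only if the fractional part of [z] is less than
   [e]. *)
exists 0, 0; split; [lra|lra|move=> z].
move=> /(eq_crossesP alpha01) /(_ q (leqnn q)); rewrite DE.
rewrite (_ : 0 + _ = 1 - e + (p - 1)%:~R); last by rewrite intrB; ring.
rewrite floorD_intr floor0 (@floor_def _ (1 - e) 0); last first.
  by rewrite add0r; apply/andP; split; lra.
rewrite add0r subr0 (_ : z + _ = z - e + p%:~R); last by ring.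
rewrite floorD_intr addrAC [RHS]addrC => /addIr ze.
have /andP[z1 z2] := floor_itv z; rewrite intrD mulr1z in z2.
have := floorD1_gt (z - e); have -> : Num.floor (z - e) = Num.floor z - 1.
  by rewrite -ze [RHS]addrC subrK.
by rewrite subrK => ?; rewrite /in_cell; apply/andP; split; lra.
Qed.

(* Pigeonhole: the points i e, i < 1/e, all enter a cell of length e within
   K q steps of the rotation, and no two of them at the same time. *)
Lemma linearly_recurrent_badly_approximable (x : biseq) K (q : nat) (p : int) :
  minimal (sturmian_subshift alpha) ->
  points (sturmian_subshift alpha) x -> linearly_recurrent_with K x ->
  (0 < q)%N -> 1 < ((K.+2 * q)%N)%:R * `|q%:R * alpha - p%:~R|.
Proof.
move=> minX Xx lrx q0; set e := `|_|.
have [e1|e1] := leP 1 e.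
  apply: (@lt_le_trans _ _ (K.+2 * q)%N%:R); first by rewrite ltr1n; lia.
  by rewrite ler_peMr.
have e0 : 0 < e.
  rewrite normr_gt0 subr_eq0.
  apply: (@irrational_neq _ _ alpha_irr q%:Z p); lia.
have [s [a [a0 a1 sP]]] := short_cell (introT andP (conj e0 e1)) erefl.
pose M := Num.truncn e^-1.
have /andP[M1 M2] : M%:R <= e^-1 < M.+1%:R.
  by apply: truncn_itv; rewrite invr_ge0 ltW.
have Me : M%:R * e <= 1 by rewrite -ler_pdivlMr// mul1r.
have cover i : exists k : 'I_(K * q).+1,
    in_cell a e (i%:R * e + k%:R * alpha).
  have [k kK kP] := linearly_recurrent_cover s minX Xx lrx q0 (i%:R * e).
  by exists (Ordinal (kK : (k < (K * q).+1)%N)); exact: sP.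
have [f fP] := choice cover.
have finj i j : (i < j < M)%N -> f i != f j.
  move=> /andP[ij jM]; apply/eqP => fij.
  have := fP i; have := fP j; rewrite -fij /in_cell.
  set z := i%:R * e + _.
  have -> : j%:R * e + (f i)%:R * alpha = z + (j - i)%N%:R * e.
    by rewrite natrB ?(ltnW ij)// /z; ring.
  have ji : (1 <= j - i)%N by rewrite subn_gt0.
  (* The two points stay at a distance between [e] and [1 - e], hence at least [e] apart on the
     circle, and a half-open arc of length [e] cannot contain both. *)
  have d1 : e <= (j - i)%N%:R * e by apply: ler_peMl; [exact: ltW|rewrite ler1n].
  have d2 : (j - i)%N%:R * e <= 1 - e.
    rewrite lerBrDr (_ : _ + e = (j - i).+1%:R * e); last by rewrite -natr1; ring.
    apply: le_trans Me; apply: ler_wpM2r; first exact: ltW.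
    by rewrite ler_nat (leq_trans _ jM)// ltnS leq_subr.
  set d := (j - i)%N%:R * e in d1 d2 *.
  move=> /andP[y1 y2] /andP[z1 z2].
  have [g gE] : exists g : int, Num.floor (z + d) = Num.floor z + g.
    by exists (Num.floor (z + d) - Num.floor z); rewrite [RHS]addrC subrK.
  rewrite gE intrD in y1 y2.
  have g1 : -1 < g%:~R :> R by lra.
  have g2 : g%:~R < 1 :> R by lra.
  have g0 : g = 0.
    by move: g1 g2; rewrite -[1](mulr1z 1) -mulrNz !ltr_int; clear; lia.
  rewrite g0 in y1 y2; lra.
have : (M <= (K * q).+1)%N.
  rewrite -[M]card_ord -[X in (_ <= X)%N]card_ord.
  apply: (@leq_card _ _ (fun i : 'I_M => f i)) => i j fij; apply/val_inj/eqP => /=.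
  case: ltngtP => // ij.
    by have := finj i j; rewrite ij ltn_ord fij eqxx => /(_ isT).
  by have := finj j i; rewrite ij ltn_ord fij eqxx => /(_ isT).
(* Here [1/e < M + 1 <= K q + 2 <= (K + 2) q], since [q >= 1]. *)
move=> MK; rewrite mulrC -ltr_pdivrMl// mulr1; apply: lt_le_trans M2 _.
by rewrite ler_nat; lia.
Qed.

Lemma linearly_recurrent_bounded :
  linearly_recurrent (sturmian_subshift alpha) -> bounded_partial_quotients alpha.
Proof.
move=> [minX [x Xx [K lrx]]]; exists K.+2 => -[|k].
  have := cf_coef0 alpha01; rewrite /cf_coef; lia.
rewrite partial_quotientE//.
have q0 := cf_den_gt0 alpha01 alpha_irr k.
have := linearly_recurrent_badly_approximable (cf_num alpha k.+1)%:Z minX Xx lrx q0.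
rewrite -/(cf_diff alpha k.+1) cf_diffE normrM normrX normrN1 expr1n mul1r.
have e0 := cf_err_gt0 alpha01 alpha_irr k.+1.
rewrite gtr0_norm// => lt1; have le1 := cf_err_den alpha01 alpha_irr k.+1.
have : (cf_den alpha k.+2)%:R < (K.+2 * cf_den alpha k.+1)%N%:R :> R.
  by rewrite -(ltr_pM2l e0) (le_lt_trans le1)// mulrC.
rewrite ltr_nat cf_denSS => lt2; rewrite ger0_norm// lez_nat.
nia.
Qed.

End recurrent_to_bounded.

Theorem proposition10 (R : realType) (alpha : R)
  (alpha01 : 0 < alpha < 1) (alpha_irr : irrational alpha) :
  linearly_recurrent (sturmian_subshift alpha)
  <-> bounded_partial_quotients alpha.
Proof.
split; first exact: linearly_recurrent_bounded.
exact: bounded_linearly_recurrent.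
Qed.
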